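(* Let $A$ be a set and let $M\le A^A$ be a submonoid of the monoid of all maps $A\to A$ such that $M$ is fungible and admits least supports. Then the forgetful functor $U\colon \mathsf{Nom}(M)\to\mathsf{Supp}(A)$ is monadic, and $\mathsf{Nom}(M)=\mathsf{EM}(M\bullet(-))$, i.e. $\mathsf{Nom}(M)$ is (with $U$ as the forgetful functor) the Eilenberg–Moore category of the monad $M\bullet(-)$ on $\mathsf{Supp}(A)$.
   Context: Supported sets: for a set $A$, the category $\mathsf{Supp}(A)$ has as objects sets $X$ with a map $\mathsf{s}_X\colon X\to\mathcal{P}_{\mathsf f}(A)$ (finite subsets of $A$); morphisms $f\colon X\to Y$ are maps with $\mathsf{s}_Y(f(x))\subseteq \mathsf{s}_X(x)$ for all $x\in X$. $M\le A^A$ means that $M$ is a submonoid of $(A^A,\circ,\mathrm{id}_A)$. For $S\subseteq A$ and $m,m'\in M$ write $m\approx_S m'$ if $m(a)=m'(a)$ for all $a\in S$. An $M$-set is a set with a left action of the monoid $M$; equivariant maps are maps commuting with the actions. A set $S\subseteq A$ supports an element $x$ of an $M$-set if $m\approx_S m'$ implies $m\cdot x=m'\cdot x$ for all $m,m'\in M$. An $M$-set is nominal if each of its elements is supported by some finite subset of $A$. $\mathsf{Nom}(M)$ is the category of nominal $M$-sets and equivariant maps. $M$ admits least supports if each element $x$ of each nominal $M$-set $X$ has a least (w.r.t. inclusion) finite support, denoted $\mathsf{supp}_X(x)$. In this case $U\colon\mathsf{Nom}(M)\to\mathsf{Supp}(A)$ sends $(X,\cdot)$ to $(X,\mathsf{supp}_X)$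 and an equivariant map to its underlying map. $M$ is fungible if for all finite $R\subseteq A$ and all $a\in A\setminus R$ there is $\ell\in M$ with $\ell\approx_R\mathrm{id}_A$ and $\ell(a)\ne a$. The functor $M\bullet(-)\colon\mathsf{Supp}(A)\to\mathsf{Supp}(A)$: let $[m]_S$ be the $\approx_S$-equivalence class of $m\in M$. Then $M\bullet X=\{([m]_{\mathsf{s}_X(x)},x)\mid m\in M,x\in X\}$ with $\mathsf{s}([m]_{\mathsf{s}_X(x)},x)=m[\mathsf{s}_X(x)]$ (the image), and $(M\bullet f)([m]_{\mathsf{s}_X(x)},x)=([m]_{\mathsf{s}_Y(f(x))},f(x))$. The set $M\bullet X$ carries the nominal $M$-set structure $\ell\cdot([m]_{\mathsf{s}(x)},x)=([\ell\cdot m]_{\mathsf{s}(x)},x)$, giving a functor $F\colon\mathsf{Supp}(A)\to\mathsf{Nom}(M)$, left adjoint to $U$ with unit $\eta_X(x)=([\mathrm{id}_A]_{\mathsf{s}(x)},x)$; the monad structure on $M\bullet(-)$ is the one induced by this adjunction. A functor $U\colon\mathcal D\to\mathcal C$ is monadic if there is a monad $T$ on $\mathcal C$ such that $\mathcal D$ is $\mathsf{EM}(T)$ and $U$ is the forgetful functor, where the identification of $\mathcal D$ with $\mathsf{EM}(T)$ is an isomorphism of categories commuting with the functors to $\mathcal C$. *)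

(* Defs.v *)
From mathcomp Require Import all_boot.
From mathcomp Require Import mathcomp_extra boolp classical_sets functions.
From mathcomp Require Import cardinality.

Set Implicit Arguments.
Unset Strict Implicit.
Unset Printing Implicit Defensive.

Local Open Scope classical_set_scope.

(* Functors are compared by Leibniz equality, so that isomorphism of categories
   and commutation with the functors to the base are meant on the nose. *)

Record category := Category {
  obj :> Type;
  hom : obj -> obj -> Type;
  idm : forall X, hom X X;
  comp : forall X Y Z, hom Y Z -> hom X Y -> hom X Z;
  comp1m : forall X Y (f : hom X Y), comp (idm Y) f = f;
  compm1 : forall X Y (f : hom X Y), comp f (idm X) = f;
  compmA : forall X Y Z W (h : hom Z W) (g : hom Y Z) (f : hom X Y),
    comp h (comp g f) = comp (comp h g) f }.
Arguments hom {c}.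
Arguments idm {c}.
Arguments comp {c X Y Z}.

Infix "\oc" := comp (at level 50, left associativity).

Record functor (C D : category) := Functor {
  fobj :> C -> D;
  fmap : forall X Y, hom X Y -> hom (fobj X) (fobj Y);
  fmap1 : forall X, fmap (idm X) = idm (fobj X);
  fmapM : forall X Y Z (g : hom Y Z) (f : hom X Y),
    fmap (g \oc f) = fmap g \oc fmap f }.
Arguments fmap {C D} _ {X Y}.

Program Definition functor_id (C : category) : functor C C :=
  @Functor C C (fun X => X) (fun X Y f => f) _ _.

Program Definition functor_comp (C D E : category) (G : functor D E)
    (F : functor C D) : functor C E :=
  @Functor C E (fun X => G (F X)) (fun X Y f => fmap G (fmap F f)) _ _.
Next Obligation. by rewrite !fmap1. Qed.
Next Obligation. by rewrite !fmapM. Qed.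

Definition is_category_iso (C D : category) (K : functor C D) :=
  exists L : functor D C,
    functor_comp L K = functor_id C /\ functor_comp K L = functor_id D.

Record monad (C : category) := Monad {
  mfun :> functor C C;
  munit : forall X, hom X (mfun X);
  mmult : forall X, hom (mfun (mfun X)) (mfun X);
  munit_nat : forall X Y (f : hom X Y),
    munit Y \oc f = fmap mfun f \oc munit X;
  mmult_nat : forall X Y (f : hom X Y),
    mmult Y \oc fmap mfun (fmap mfun f) = fmap mfun f \oc mmult X;
  mmult_unitl : forall X, mmult X \oc munit (mfun X) = idm (mfun X);
  mmult_unitr : forall X, mmult X \oc fmap mfun (munit X) = idm (mfun X);
  mmultA : forall X, mmult X \oc mmult (mfun X) = mmult X \oc fmap mfun (mmult X) }.
Arguments munit {C}.
Arguments mmult {C}.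

Section EilenbergMoore.
Variables (C : category) (T : monad C).

Record em_obj := EMObj {
  em_car : C;
  em_str : hom (T em_car) em_car;
  em_unit : em_str \oc munit T em_car = idm em_car;
  em_mult : em_str \oc mmult T em_car = em_str \oc fmap T em_str }.

Record em_hom (a b : em_obj) := EMHom {
  em_map : hom (em_car a) (em_car b);
  em_mapP : em_map \oc em_str a = em_str b \oc fmap T em_map }.

Lemma em_hom_eq a b (f g : em_hom a b) : em_map f = em_map g -> f = g.
Proof.
by case: f g => [f Hf] [g Hg] /= e; subst g; congr EMHom; exact: Prop_irrelevance.
Qed.

Program Definition em_idm (a : em_obj) : em_hom a a := @EMHom a a (idm _) _.
Next Obligation. by rewrite fmap1 comp1m compm1. Qed.

Program Definition em_comp (a b c : em_obj) (g : em_hom b c) (f : em_hom a b) :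
  em_hom a c := @EMHom a c (em_map g \oc em_map f) _.
Next Obligation. by rewrite fmapM -compmA em_mapP compmA em_mapP compmA. Qed.

Program Definition EMcat : category := @Category em_obj em_hom em_idm em_comp _ _ _.
Next Obligation. by apply: em_hom_eq; exact: comp1m. Qed.
Next Obligation. by apply: em_hom_eq; exact: compm1. Qed.
Next Obligation. by apply: em_hom_eq; exact: compmA. Qed.

Program Definition EM_forget : functor EMcat C :=
  @Functor EMcat C em_car (fun a b f => em_map f) _ _.

End EilenbergMoore.

Definition is_EM_of (C D : category) (U : functor D C) (T : monad C) :=
  exists K : functor D (EMcat T),
    is_category_iso K /\ functor_comp (EM_forget T) K = U.

Definition monadic (C D : category) (U : functor D C) :=
  exists T : monad C, is_EM_of U T.

Record adjunction (C D : category) (F : functor C D) (U : functor D C) :=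
  Adjunction {
  adj_unit : forall X, hom X (U (F X));
  adj_counit : forall Y, hom (F (U Y)) Y;
  adj_unit_nat : forall X X' (f : hom X X'),
    adj_unit X' \oc f = fmap U (fmap F f) \oc adj_unit X;
  adj_counit_nat : forall Y Y' (g : hom Y Y'),
    g \oc adj_counit Y = adj_counit Y' \oc fmap F (fmap U g);
  adj_triangleL : forall X, adj_counit (F X) \oc fmap F (adj_unit X) = idm (F X);
  adj_triangleR : forall Y, fmap U (adj_counit Y) \oc adj_unit (U Y) = idm (U Y) }.

Program Definition adjunction_monad (C D : category) (F : functor C D)
    (U : functor D C) (a : adjunction F U) : monad C :=
  @Monad C (functor_comp U F) (adj_unit a) (fun X => fmap U (adj_counit a (F X)))
    _ _ _ _ _.
Next Obligation. exact: adj_unit_nat. Qed.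
Next Obligation. by rewrite -!fmapM adj_counit_nat. Qed.
Next Obligation. exact: adj_triangleR. Qed.
Next Obligation. by rewrite -fmapM adj_triangleL fmap1. Qed.
Next Obligation. by rewrite -!fmapM adj_counit_nat. Qed.

Section Supp.
Variable A : Type.

Record supp_obj := SuppObj {
  scar :> Type;
  ssupp : scar -> set A;
  ssupp_fin : forall x, finite_set (ssupp x) }.
Arguments ssupp {s}.

Record supp_hom (X Y : supp_obj) := SuppHom {
  sfun :> X -> Y;
  sfunP : forall x, ssupp (sfun x) `<=` ssupp x }.

Lemma supp_hom_eq X Y (f g : supp_hom X Y) : f =1 g -> f = g.
Proof.
case: f g => [f Hf] [g Hg] /= /funext e; subst g.
by congr SuppHom; exact: Prop_irrelevance.
Qed.

Definition supp_idm (X : supp_obj) : supp_hom X X :=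
  @SuppHom X X (fun x => x) (fun x => @subset_refl _ _).

Definition supp_comp (X Y Z : supp_obj) (g : supp_hom Y Z) (f : supp_hom X Y) :
    supp_hom X Z :=
  @SuppHom X Z (fun x => g (f x))
    (fun x => subset_trans (@sfunP _ _ g (f x)) (@sfunP _ _ f x)).

Program Definition Supp : category :=
  @Category supp_obj supp_hom supp_idm supp_comp _ _ _.
Next Obligation. exact: supp_hom_eq. Qed.
Next Obligation. exact: supp_hom_eq. Qed.
Next Obligation. exact: supp_hom_eq. Qed.

End Supp.
Arguments ssupp {A s}.

Record submonoid (A : Type) := Submonoid {
  smset : set (A -> A);
  sm_id : smset id;
  sm_comp : forall m l, smset m -> smset l -> smset (m \o l) }.

Section NominalSets.
Variables (A : Type) (M : submonoid A).

Record melt := MElt { mfn :> A -> A; mfnP : smset M mfn }.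

Lemma melt_eq (m l : melt) : m =1 l -> m = l.
Proof.
case: m l => [f Hf] [g Hg] /= /funext e; subst g.
by congr MElt; exact: Prop_irrelevance.
Qed.

Definition m1 : melt := MElt (sm_id M).
Definition mmul (m l : melt) : melt := MElt (sm_comp (mfnP m) (mfnP l)).

Definition approx (S : set A) (m l : A -> A) := forall a, S a -> m a = l a.

Record mset := MSet {
  mcar :> Type;
  act : melt -> mcar -> mcar;
  act1 : forall x, act m1 x = x;
  actM : forall m l x, act (mmul m l) x = act m (act l x) }.
Arguments act {_}.

Definition supports (X : mset) (S : set A) (x : X) :=
  forall m l : melt, approx S m l -> act m x = act l x.
Arguments supports {_}.

Definition is_nominal (X : mset) :=
  forall x : X, exists S, finite_set S /\ supports S x.

Definition is_least_support (X : mset) (x : X) (S : set A) :=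
  [/\ finite_set S, supports S x &
      forall S', finite_set S' -> supports S' x -> S `<=` S'].

Record nom_obj := NomObj { nset :> mset; nsetP : is_nominal nset }.

Record equivar (X Y : mset) := Equivar {
  efun :> X -> Y;
  efunP : forall m x, efun (act m x) = act m (efun x) }.

Lemma equivar_eq X Y (f g : equivar X Y) : f =1 g -> f = g.
Proof.
case: f g => [f Hf] [g Hg] /= /funext e; subst g.
by congr Equivar; exact: Prop_irrelevance.
Qed.

Definition equivar_idm (X : mset) : equivar X X :=
  @Equivar X X (fun x => x) (fun m x => erefl).

Program Definition equivar_comp (X Y Z : mset) (g : equivar Y Z)
  (f : equivar X Y) : equivar X Z := @Equivar X Z (fun x => g (f x)) _.
Next Obligation. by rewrite !efunP. Qed.

Program Definition Nom : category :=
  @Category nom_obj equivar equivar_idm equivar_comp _ _ _.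
Next Obligation. exact: equivar_eq. Qed.
Next Obligation. exact: equivar_eq. Qed.
Next Obligation. exact: equivar_eq. Qed.

Definition admits_least_supports :=
  forall (X : nom_obj) (x : X), exists S, is_least_support x S.

Definition fungible :=
  forall (R : set A) (a : A), finite_set R -> ~ R a ->
    exists l : melt, approx R l id /\ l a <> a.

Section Forgetful.
Hypothesis ls : admits_least_supports.

Definition supp (X : nom_obj) (x : X) : set A := sval (cid (ls x)).

Lemma suppP (X : nom_obj) (x : X) : is_least_support x (supp x).
Proof. exact: svalP (cid (ls x)). Qed.

Lemma supp_unique (X : nom_obj) (x : X) S : is_least_support x S -> supp x = S.
Proof.
have [f s l] := suppP x; move=> [f' s' l'].
by rewrite eqEsubset; split; [exact: l|exact: l'].
Qed.

Lemma supp_fin (X : nom_obj) (x : X) : finite_set (supp x).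
Proof. by have [] := suppP x. Qed.

Lemma equivar_supp (X Y : nom_obj) (f : equivar X Y) (x : X) :
  supp (f x) `<=` supp x.
Proof.
have [fx sx _] := suppP x; have [_ _ l] := suppP (f x).
by apply: l => // m n mn; rewrite -!efunP (sx _ _ mn).
Qed.

Definition U_obj (X : nom_obj) : supp_obj A := SuppObj (@supp_fin X).

Program Definition U : functor Nom (Supp A) :=
  @Functor Nom (Supp A) U_obj
    (fun X Y f => @SuppHom A (U_obj X) (U_obj Y) f (@equivar_supp X Y f)) _ _.
Next Obligation. exact: supp_hom_eq. Qed.
Next Obligation. exact: supp_hom_eq. Qed.

End Forgetful.

Definition mclass (S : set A) (m : melt) : set melt := [set l | approx S m l].

Lemma mclass_eq S m l : mclass S m = mclass S l <-> approx S m l.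
Proof.
split=> [e|ml]; last first.
  rewrite /mclass predeqE => n /=.
  by split=> H a Sa; rewrite -H ?ml // -ml.
have : mclass S l l by [].
by rewrite -e.
Qed.

(* The pairs ([m]_{s(x)}, x) *)
Record bullet (X : supp_obj A) := Bullet {
  bcls : set melt;
  belt : X;
  bclsP : exists m, bcls = mclass (ssupp belt) m }.

Section BulletSet.
Variable X : supp_obj A.

Definition bmk (m : melt) (x : X) : bullet X :=
  @Bullet X (mclass (ssupp x) m) x (ex_intro _ m erefl).

(* A chosen representative; the operations defined through it are shown
   independent of the choice in [bsupp_mk], [bact_mk], [bmap_mk]
   and [bmult_mk]. *)
Definition brep (q : bullet X) : melt := sval (cid (bclsP q)).

Lemma bmk_eq m l x : bmk m x = bmk l x <-> approx (ssupp x) m l.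
Proof.
rewrite -mclass_eq; split=> [/(congr1 (@bcls X)) //|e].
rewrite /bmk; move: (ex_intro _ _ _) (ex_intro _ _ _); rewrite e => p q.
by congr Bullet; exact: Prop_irrelevance.
Qed.

Lemma brepK (q : bullet X) : bmk (brep q) (belt q) = q.
Proof.
rewrite /brep; case: cid => m /=; case: q => c x p /= e; subst c.
by congr Bullet; exact: Prop_irrelevance.
Qed.

Lemma brep_mk m x : approx (ssupp x) (brep (bmk m x)) m.
Proof. by apply/bmk_eq; exact: (brepK (bmk m x)). Qed.

Definition bsupp (q : bullet X) : set A := brep q @` ssupp (belt q).

Lemma bsupp_mk m x : bsupp (bmk m x) = m @` ssupp x.
Proof.
rewrite predeqE => b; rewrite /bsupp /=.
by split=> -[a Sa <-]; exists a => //; rewrite brep_mk.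
Qed.

Lemma bsupp_fin q : finite_set (bsupp q).
Proof. exact/finite_image/ssupp_fin. Qed.

Definition bact (l : melt) (q : bullet X) : bullet X :=
  bmk (mmul l (brep q)) (belt q).

Lemma bact_mk l m x : bact l (bmk m x) = bmk (mmul l m) x.
Proof. by apply/bmk_eq => a Sa /=; rewrite brep_mk. Qed.

End BulletSet.

Definition bullet_obj (X : supp_obj A) : supp_obj A := SuppObj (@bsupp_fin X).

Definition bmap (X Y : supp_obj A) (f : supp_hom X Y) (q : bullet X) : bullet Y :=
  bmk (brep q) (f (belt q)).

Lemma bmap_mk (X Y : supp_obj A) (f : supp_hom X Y) m x :
  bmap f (bmk m x) = bmk m (f x).
Proof. by apply/bmk_eq => a /(@sfunP _ _ _ f) Sa; rewrite brep_mk. Qed.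

Lemma bmap_supp (X Y : supp_obj A) (f : supp_hom X Y) (q : bullet X) :
  bsupp (bmap f q) `<=` bsupp q.
Proof.
rewrite -(brepK q) bmap_mk !bsupp_mk.
exact/image_subset/sfunP.
Qed.

Definition bullet_map (X Y : supp_obj A) (f : supp_hom X Y) :
    supp_hom (bullet_obj X) (bullet_obj Y) :=
  @SuppHom A (bullet_obj X) (bullet_obj Y) (bmap f) (@bmap_supp X Y f).

Lemma bmap_id X q : bmap (supp_idm X) q = q.
Proof. by rewrite -{1}(brepK q) bmap_mk brepK. Qed.

Lemma bmap_comp (X Y Z : supp_obj A) (g : supp_hom Y Z) (f : supp_hom X Y) q :
  bmap (supp_comp g f) q = bmap g (bmap f q).
Proof. by rewrite -(brepK q) !bmap_mk. Qed.

Program Definition bullet_functor : functor (Supp A) (Supp A) :=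
  @Functor (Supp A) (Supp A) bullet_obj bullet_map _ _.
Next Obligation. by apply: supp_hom_eq => q; exact: bmap_id. Qed.
Next Obligation. by apply: supp_hom_eq => q; exact: bmap_comp. Qed.


Definition bunit (X : supp_obj A) (x : X) : bullet X := bmk m1 x.

Lemma bunit_supp (X : supp_obj A) (x : X) : bsupp (@bunit X x) `<=` ssupp x.
Proof. by rewrite bsupp_mk image_id. Qed.

Definition bullet_unit (X : supp_obj A) : supp_hom X (bullet_obj X) :=
  @SuppHom A X (bullet_obj X) (@bunit X) (@bunit_supp X).

Definition bmult (X : supp_obj A) (q : bullet (bullet_obj X)) : bullet X :=
  bact (brep q) (belt q).

Lemma bact_approx X (l l' : melt) (q : bullet X) :
  approx (bsupp q) l l' -> bact l q = bact l' q.
Proof.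
rewrite -(brepK q) bsupp_mk !bact_mk => ll'.
by apply/bmk_eq => a Sa /=; apply: ll'; exists a.
Qed.

Lemma bmult_mk (X : supp_obj A) (l m : melt) (x : X) :
  bmult (@bmk (bullet_obj X) l (bmk m x)) = bmk (mmul l m) x.
Proof. by rewrite -bact_mk; apply: bact_approx; exact: (@brep_mk (bullet_obj X)). Qed.

Lemma bmult_supp X q : bsupp (@bmult X q) `<=` bsupp q.
Proof.
rewrite -(brepK q) -(brepK (belt q)) bmult_mk !bsupp_mk /= bsupp_mk.
by rewrite image_comp.
Qed.

Definition bullet_mult (X : supp_obj A) :
    supp_hom (bullet_obj (bullet_obj X)) (bullet_obj X) :=
  @SuppHom A (bullet_obj (bullet_obj X)) (bullet_obj X)
    (@bmult X) (@bmult_supp X).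

Lemma bulletW X (P : bullet X -> Prop) :
  (forall m x, P (bmk m x)) -> forall q, P q.
Proof. by move=> H q; rewrite -(brepK q). Qed.

Lemma bullet2W X (P : bullet (bullet_obj X) -> Prop) :
  (forall l m x, P (@bmk (bullet_obj X) l (bmk m x))) -> forall q, P q.
Proof. by move=> H; apply: bulletW => l; apply: bulletW. Qed.

(* The multiplication is ([l], ([m], x)) |-> ([l \o m], x), see [bmult_mk].
   For fungible M this is the monad induced by the adjunction between F and U,
   see [bullet_monadE]; without fungibility the supports on [bullet_obj X] and
   on [U (F X)] may differ. *)
Program Definition bullet_monad : monad (Supp A) :=
  @Monad (Supp A) bullet_functor bullet_unit bullet_mult _ _ _ _ _.
Next Obligation.
by apply: supp_hom_eq => x /=; rewrite /bunit bmap_mk.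
Qed.
Next Obligation.
apply: supp_hom_eq; apply: bullet2W => l m x /=.
by rewrite bmap_mk /= bmap_mk !bmult_mk bmap_mk.
Qed.
Next Obligation.
apply: supp_hom_eq; apply: bulletW => m x /=.
by rewrite /bunit bmult_mk; apply/bmk_eq.
Qed.
Next Obligation.
apply: supp_hom_eq; apply: bulletW => m x /=.
by rewrite bmap_mk /= /bunit bmult_mk; apply/bmk_eq.
Qed.
Next Obligation.
apply: supp_hom_eq; apply: bulletW => k; apply: bullet2W => l m x /=.
by rewrite bmap_mk /= !bmult_mk; apply/bmk_eq.
Qed.

Lemma bact1 X (q : bullet X) : bact m1 q = q.
Proof. by elim/bulletW: q => m x; rewrite bact_mk; apply/bmk_eq. Qed.

Lemma bactM X l m (q : bullet X) : bact (mmul l m) q = bact l (bact m q).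
Proof. by elim/bulletW: q => n x; rewrite !bact_mk; apply/bmk_eq. Qed.

Definition free_mset (X : supp_obj A) : mset := MSet (@bact1 X) (@bactM X).

Lemma bsupp_supports X (q : free_mset X) : supports (bsupp q) q.
Proof. by move=> l l'; exact: bact_approx. Qed.

Lemma free_nominal X : is_nominal (free_mset X).
Proof.
move=> q; exists (bsupp q); split; first exact: bsupp_fin.
exact: bsupp_supports.
Qed.

Definition F_obj (X : supp_obj A) : nom_obj := NomObj (@free_nominal X).

Lemma bmap_equivar (X Y : supp_obj A) (f : supp_hom X Y) l (q : bullet X) :
  bmap f (bact l q) = bact l (bmap f q).
Proof. by elim/bulletW: q => m x; rewrite bact_mk !bmap_mk bact_mk. Qed.

Program Definition F : functor (Supp A) Nom :=
  @Functor (Supp A) Nom F_obj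
    (fun X Y f => @Equivar (F_obj X) (F_obj Y) (bmap f) (bmap_equivar f)) _ _.
Next Obligation. by apply: equivar_eq => q; exact: bmap_id. Qed.
Next Obligation. by apply: equivar_eq => q; exact: bmap_comp. Qed.

Section Adjunction.
Hypothesis ls : admits_least_supports.

Lemma F_unit_supp (X : supp_obj A) (x : X) :
  @supp ls (F_obj X) (bunit x) `<=` ssupp x.
Proof.
have [_ _ l] := suppP ls (bunit x : F_obj X).
apply: subset_trans (@bunit_supp X x).
by apply: l; [exact: bsupp_fin|exact: bsupp_supports].
Qed.

Definition F_unit (X : supp_obj A) : supp_hom X (U ls (F X)) :=
  @SuppHom A X (U_obj ls (F_obj X)) (@bunit X) (@F_unit_supp X).

Definition eval (Y : nom_obj) (q : bullet (U_obj ls Y)) : Y :=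
  act (brep q) (belt q : Y).

Lemma eval_mk (Y : nom_obj) m (y : Y) : eval (@bmk (U_obj ls Y) m y) = act m y.
Proof.
by have [_ s _] := suppP ls y; apply: s; exact: (@brep_mk (U_obj ls Y)).
Qed.

Lemma eval_equivar (Y : nom_obj) l (q : bullet (U_obj ls Y)) :
  eval (bact l q) = act l (eval q).
Proof. by elim/bulletW: q => m y; rewrite bact_mk !eval_mk actM. Qed.

Definition F_counit (Y : nom_obj) : equivar (F (U ls Y)) Y :=
  @Equivar (F_obj (U_obj ls Y)) Y (@eval Y) (@eval_equivar Y).

Program Definition FU_adjunction : adjunction F (U ls) :=
  @Adjunction _ _ F (U ls) F_unit F_counit _ _ _ _.
Next Obligation.
by apply: supp_hom_eq => x /=; rewrite /bunit bmap_mk.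
Qed.
Next Obligation.
apply: equivar_eq; apply: bulletW => m y /=.
by rewrite bmap_mk !eval_mk efunP.
Qed.
Next Obligation.
apply: equivar_eq; apply: bulletW => m x /=.
by rewrite bmap_mk eval_mk /= /bunit bact_mk; apply/bmk_eq.
Qed.
Next Obligation.
by apply: supp_hom_eq => y /=; rewrite /bunit eval_mk act1.
Qed.

Lemma supp_free (X : supp_obj A) (q : bullet X) :
  fungible -> @supp ls (F_obj X) q = bsupp q.
Proof.
move=> fung; apply: supp_unique; split=> [||S finS suppS].
- exact: bsupp_fin.
- exact: bsupp_supports.
elim/bulletW: q suppS => m x suppS; rewrite bsupp_mk => _ [a sa <-].
apply: contrapT => nS; have [l [lS lm]] := fung S (m a) finS nS.
have : bact l (bmk m x) = bact m1 (bmk m x) by exact: suppS.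
by rewrite !bact_mk => /bmk_eq /(_ a sa).
Qed.

(* The carriers of [bullet_obj (bullet_obj X)] and of [U (F (U (F X)))] are the
   same set of pairs only once the two support maps are known to agree; hence
   the arbitrary support map [sigma]. *)
Lemma bullet_monad_uniq (sigma : forall X, bullet X -> set A)
    (fin : forall X q, finite_set (@sigma X q))
    (T := fun X => SuppObj (fin X)) fm fm1 fmM
    (T' := @Functor (Supp A) (Supp A) T fm fm1 fmM)
    (unit : forall X : supp_obj A, supp_hom X (T X))
    (mult : forall X : supp_obj A, supp_hom (T (T X)) (T X)) un mn ul ur as' :
  (forall X, sigma X = @bsupp X) ->
  (forall X Y (f : supp_hom X Y) q, (fm X Y f : supp_hom (T X) (T Y)) q = bmap f q) ->
  (forall X x, unit X x = bunit x) ->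
  (forall X q, mult X q = bact (brep q) (belt q)) ->
  bullet_monad = @Monad (Supp A) T' unit mult un mn ul ur as'.
Proof.
move=> sigmaE; have e := functional_extensionality_dep sigmaE; subst sigma.
have ? : fin = bsupp_fin by exact: Prop_irrelevance.
subst fin => fmE unitE multE.
have ? : bullet_map = fm.
  do 3![apply: functional_extensionality_dep => ?].
  by apply: supp_hom_eq => q; rewrite fmE.
subst fm.
have ? : bullet_unit = unit.
  by apply: functional_extensionality_dep => X; apply: supp_hom_eq => q; rewrite unitE.
subst unit.
have ? : bullet_mult = mult.
  by apply: functional_extensionality_dep => X; apply: supp_hom_eq => q; rewrite multE.
subst mult.
rewrite /bullet_monad; move: bullet_monad_obligation_1 bullet_monad_obligation_2
  bullet_monad_obligation_3 bullet_monad_obligation_4 bullet_monad_obligation_5.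
rewrite /T' /bullet_functor (Prop_irrelevance bullet_functor_obligation_1 fm1).
rewrite (Prop_irrelevance bullet_functor_obligation_2 fmM) => *.
congr Monad; exact: Prop_irrelevance.
Qed.

Lemma bullet_monadE : fungible -> bullet_monad = adjunction_monad FU_adjunction.
Proof.
move=> fung; apply: bullet_monad_uniq => // X.
by apply/funext => q; exact: supp_free.
Qed.

End Adjunction.

End NominalSets.

(* Main.v *)
From mathcomp Require Import all_boot.
From mathcomp Require Import boolp classical_sets functions cardinality.
Require Import Defs.

(** An algebra [alpha : M • X -> X] is the same thing as the action
    [m · x = alpha ([m], x)], which is supported by [s x].  The only point is that
    [s x] is the least support.  If a finite [S] supports [x] and [a] lies in [s x]
    but not in [S], fungibility gives [l] fixing [S] and [s x] minus [a] pointwise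
    and moving [a].  Then [l · x = x], and since [alpha] is a morphism of supported
    sets, [s x = s (l · x)] is contained in [l (s x)], which does not contain [a]. *)

Set Implicit Arguments.
Unset Strict Implicit.
Unset Printing Implicit Defensive.

Local Open Scope classical_set_scope.

(** * Strict equality of functors and isomorphism of categories *)

Section FunctorEquality.

(** Turns transport along an equality of objects into a morphism, so that hom-sets over equal
    objects are compared by equations in the category instead of casts. *)
Definition idtohom (C : category) (X Y : C) (e : X = Y) : hom X Y :=
  ecast Z (hom X Z) e (idm X).

Lemma idtohomK (C : category) (X Y : C) (e : X = Y) (e' : Y = X) :
  idtohom e' \oc idtohom e = idm X.
Proof. by subst Y; rewrite (Prop_irrelevance e' erefl) comp1m. Qed.

Lemma fmap_idtohom (C D : category) (K : functor C D) (X Y : C) (e : X = Y)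
    (e' : K X = K Y) : fmap K (idtohom e) = idtohom e'.
Proof. by subst Y; rewrite (Prop_irrelevance e' erefl) fmap1. Qed.

Lemma functor_eq (C D : category) (F G : functor C D) (e : forall X, F X = G X) :
  (forall X Y (f : hom X Y),
    idtohom (e Y) \oc fmap F f = fmap G f \oc idtohom (e X)) -> F = G.
Proof.
case: F G e => [F Ff F1 FM] [G Gf G1 GM] /= e.
have eFG : F = G by apply/funext.
subst G => nat.
have fE : Ff = Gf.
  apply: functional_extensionality_dep => X.
  apply: functional_extensionality_dep => Y; apply/funext => f.
  have := nat X Y f.
  by rewrite !(Prop_irrelevance (e _) erefl) comp1m compm1.
by subst Gf; congr Functor; exact: Prop_irrelevance.
Qed.

(** Fullness extends [g] to morphisms, and faithfulness makes the extension functorial. *)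
Lemma fully_faithful_iso (C D : category) (K : functor C D) (g : D -> C) :
  (forall X Y (f f' : hom X Y), fmap K f = fmap K f' -> f = f') ->
  (forall X Y (h : hom (K X) (K Y)), exists f, fmap K f = h) ->
  cancel K g -> cancel g K -> is_category_iso K.
Proof.
move=> faithful full KK gK.
pose Lmap X Y (f : hom X Y) : hom (g X) (g Y) :=
  sval (cid (full _ _ (idtohom (esym (gK Y)) \oc f \oc idtohom (gK X)))).
have KL X Y (f : hom X Y) :
    fmap K (Lmap _ _ f) = idtohom (esym (gK Y)) \oc f \oc idtohom (gK X).
  by rewrite /Lmap; case: cid.
have L1 X : Lmap _ _ (idm X) = idm (g X).
  by apply: faithful; rewrite KL compm1 idtohomK fmap1.
have LM X Y Z (h : hom Y Z) (f : hom X Y) :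
    Lmap _ _ (h \oc f) = Lmap _ _ h \oc Lmap _ _ f.
  apply: faithful; rewrite fmapM !KL -!compmA; congr (_ \oc (_ \oc _)).
  by rewrite [RHS]compmA idtohomK comp1m.
pose L := Functor L1 LM; exists L; split.
- apply: (@functor_eq _ _ (functor_comp L K) (functor_id C) KK) => X Y f; apply: faithful => /=.
  (* [K] sends the identification [g (K X) = X] to the one given by [gK], since proofs of equality
     are irrelevant. *)
  rewrite !fmapM KL !(fmap_idtohom (KK _) (gK _)) !compmA.
  by rewrite idtohomK comp1m.
- apply: (@functor_eq _ _ (functor_comp K L) (functor_id D) gK) => X Y f /=.
  by rewrite KL !compmA idtohomK comp1m.
Qed.

End FunctorEquality.

Section Comparison.
Variables (A : Type) (M : submonoid A).

Lemma nom_obj_eq (X : Type) (a a' : melt M -> X -> X) a1 aM a1' aM' n n' :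
  a = a' ->
  @NomObj A M (@MSet A M X a a1 aM) n = @NomObj A M (@MSet A M X a' a1' aM') n'.
Proof.
move=> e; subst a'.
move: n n'; rewrite (Prop_irrelevance a1' a1) (Prop_irrelevance aM' aM) => n n'.
by rewrite (Prop_irrelevance n n').
Qed.

(** The types of [al] and [al'] depend on the support maps, so the two are compared on the pairs
    [bmk l x], which make sense for both. *)
Lemma em_obj_eq (X : Type) (s s' : X -> set A) fin fin'
    (al : supp_hom (bullet_obj M (@SuppObj A X s fin)) (@SuppObj A X s fin))
    (al' : supp_hom (bullet_obj M (@SuppObj A X s' fin')) (@SuppObj A X s' fin'))
    u m u' m' :
  s = s' ->
  (forall l x, al (@bmk _ M (SuppObj fin) l x) = al' (@bmk _ M (SuppObj fin') l x)) ->
  @EMObj (Supp A) (bullet_monad M) _ al u m =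
  @EMObj (Supp A) (bullet_monad M) _ al' u' m'.
Proof.
move=> e; subst s'; move: al' u' m'; rewrite (Prop_irrelevance fin' fin).
move=> al' u' m' ale.
have e : al = al' by apply: supp_hom_eq; apply: bulletW.
by subst al'; congr EMObj; exact: Prop_irrelevance.
Qed.

(** * From algebras to nominal sets *)

Section AlgebraAction.
Variable a : em_obj (bullet_monad M).
Let X : supp_obj A := em_car a.
Let alpha : supp_hom (bullet_obj M X) X := em_str a.

Definition alg_act (m : melt M) (x : X) : X := alpha (bmk m x).

Lemma alg_act1 x : alg_act (m1 M) x = x.
Proof. exact: (congr1 (fun f : supp_hom X X => f x) (em_unit a)). Qed.

Lemma alg_actM m l x : alg_act (mmul m l) x = alg_act m (alg_act l x).
Proof.
(* The associativity law of the algebra, read at ([m], ([l], x)). *)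
have := congr1 (fun f : supp_hom (bullet_obj M (bullet_obj M X)) X =>
  f (@bmk _ M (bullet_obj M X) m (bmk l x))) (em_mult a).
by rewrite /= bmult_mk bmap_mk.
Qed.

Definition alg_mset : mset M := MSet alg_act1 alg_actM.

Lemma alg_supports (x : alg_mset) : supports (@ssupp A X x) x.
Proof. by move=> m l ml; congr (alpha _); apply/bmk_eq. Qed.

Lemma alg_nominal : is_nominal alg_mset.
Proof. by move=> x; exists (@ssupp A X x); split; [exact: ssupp_fin|exact: alg_supports]. Qed.

Definition alg_nom : nom_obj M := NomObj alg_nominal.

Lemma alg_act_supp m x : @ssupp A X (alg_act m x) `<=` mfn m @` @ssupp A X x.
Proof. by rewrite -bsupp_mk; exact: (@sfunP _ _ _ alpha (bmk m x)). Qed.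

Lemma alg_least_support (x : alg_mset) :
  fungible M -> is_least_support x (@ssupp A X x).
Proof.
move=> fung; split=> [||S finS suppS b sb].
- exact: ssupp_fin.
- exact: alg_supports.
apply: contrapT => nS.
have finR : finite_set (S `|` (@ssupp A X x `\` [set b])).
  by rewrite finite_setU; split=> //; apply: finite_setD; exact: ssupp_fin.
have [|l [lR lb]] := fung _ b finR; first by case=> // -[_]; apply.
have lx : alg_act l x = x.
  rewrite -[RHS]alg_act1; apply: suppS => c Sc.
  by apply: lR; left.
have := @alg_act_supp l x b; rewrite lx => /(_ sb) [c sc lc].
(* Here [l c = b] with [c] in the support of [x]. If [c = b], then [l] fixes [b], a contradiction;
   otherwise [l] fixes [c], whence [c = b] after all. *)
have [cb|cb] := EM (c = b); first by subst c.
by apply: (cb); rewrite -[RHS]lc lR //; right.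
Qed.

End AlgebraAction.

Variable ls : admits_least_supports M.

(** * The comparison functor and its inverse on objects *)

Section ComparisonFunctor.
Hypothesis fung : fungible M.

(** Equivariant maps such as the counit shrink least supports, and by fungibility the least support
    in the free nominal set is [bsupp]. *)
Lemma eval_supp (Y : nom_obj M) (q : bullet M (U_obj ls Y)) :
  supp ls (eval q) `<=` bsupp q.
Proof.
rewrite -(supp_free ls (X := U_obj ls Y) q fung).
exact: (@equivar_supp A M ls (F_obj M (U_obj ls Y)) Y (F_counit ls Y) q).
Qed.

Definition eval_hom (Y : nom_obj M) : supp_hom (bullet_obj M (U_obj ls Y)) (U_obj ls Y) :=
  @SuppHom A (bullet_obj M (U_obj ls Y)) (U_obj ls Y) (@eval A M ls Y) (@eval_supp Y).

Program Definition nom_alg (Y : nom_obj M) : em_obj (bullet_monad M) :=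
  @EMObj (Supp A) (bullet_monad M) (U_obj ls Y) (eval_hom Y) _ _.
Next Obligation.
by apply: supp_hom_eq => y; rewrite /= /bunit eval_mk act1.
Qed.
Next Obligation.
apply: supp_hom_eq; apply: bullet2W => l m y.
by rewrite /= bmult_mk bmap_mk /= !eval_mk actM.
Qed.

Program Definition nom_alg_hom (X Y : nom_obj M) (f : equivar X Y) :
    em_hom (nom_alg X) (nom_alg Y) :=
  @EMHom (Supp A) (bullet_monad M) (nom_alg X) (nom_alg Y) (fmap (U ls) f) _.
Next Obligation.
apply: supp_hom_eq; apply: bulletW => m x.
by rewrite /= bmap_mk !eval_mk efunP.
Qed.

Program Definition comparison : functor (Nom M) (EMcat (bullet_monad M)) :=
  @Functor (Nom M) (EMcat (bullet_monad M)) nom_alg nom_alg_hom _ _.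
Next Obligation. by apply: em_hom_eq; exact: supp_hom_eq. Qed.
Next Obligation. by apply: em_hom_eq; exact: supp_hom_eq. Qed.

Lemma comparison_faithful (X Y : Nom M) (f f' : hom X Y) :
  fmap comparison f = fmap comparison f' -> f = f'.
Proof.
move=> /(congr1 (@em_map _ _ _ _)) /= e; apply: equivar_eq => x.
exact: (congr1 (fun h : supp_hom (U_obj ls X) (U_obj ls Y) => h x) e).
Qed.

Lemma comparison_full (X Y : Nom M) (h : hom (comparison X) (comparison Y)) :
  exists f, fmap comparison f = h.
Proof.
case: h => h hP; move: (h : supp_hom (U_obj ls X) (U_obj ls Y)) hP => {}h hP.
(* Equivariance is the algebra morphism square read at ([m], x). *)
have hE m (x : nset X) : h (act m x) = act m (h x : nset Y).
  have := congr1 (fun f : supp_hom (bullet_obj M (U_obj ls X)) (U_obj ls Y) =>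
    f (@bmk _ M (U_obj ls X) m x)) hP.
  by rewrite /= bmap_mk !eval_mk.
exists (@Equivar A M X Y h hE).
by apply: em_hom_eq; exact: supp_hom_eq.
Qed.

Lemma nom_algK : cancel nom_alg alg_nom.
Proof.
move=> Y; have : @alg_act (nom_alg Y) = @act A M Y.
  by do 2![apply/funext => ?]; exact: eval_mk.
(* The nominality proof becomes a variable, so that [Y] can be destructed and only the actions
   remain to be compared. *)
rewrite /alg_nom /alg_mset; move: (@alg_nominal _) => n.
case: Y n => [[Y a a1 aM] nY] n e.
exact: nom_obj_eq.
Qed.

(** The given support map is recovered because it is the least support of the induced action; the
    structure map is then recovered on representatives. *)
Lemma alg_nomK : cancel alg_nom nom_alg.
Proof.
move=> a; have suppE : @supp A M ls (alg_nom a) = @ssupp A (em_car a).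
  by apply/funext => x; apply: supp_unique; exact: alg_least_support.
case: a suppE => [[X s fin] al u m] suppE.
by apply: em_obj_eq => // l x; rewrite /= eval_mk.
Qed.

End ComparisonFunctor.
End Comparison.

Theorem theorem4p9 (A : Type) (M : submonoid A)
    (fung : fungible M) (ls : admits_least_supports M) :
  monadic (U ls) /\ is_EM_of (U ls) (bullet_monad M).
Proof.
suff H : is_EM_of (U ls) (bullet_monad M) by split=> //; exists (bullet_monad M).
exists (comparison ls fung); split.
  apply: (@fully_faithful_iso _ _ (comparison ls fung) (@alg_nom A M)).
  - exact: comparison_faithful.
  - exact: comparison_full.
  - exact: nom_algK.
  - exact: alg_nomK.
(* The carrier of [nom_alg X] is [U ls X] by definition, so the identifications of objects are
   identities. *)
apply: (@functor_eq _ _ (functor_comp (EM_forget _) (comparison ls fung)) (U ls)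
  (fun X : Nom M => erefl)) => X Y f.
by rewrite comp1m compm1.
Qed.
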